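(* Let $n\ge 1$, let $C_{3n+2}$ be the cycle on $3n+2$ vertices, and let $I=I(C_{3n+2})=(x_1x_2,x_2x_3,\ldots,x_{3n+1}x_{3n+2},x_1x_{3n+2})$ be its edge ideal in the ring $R=k[x_1,\ldots,x_{3n+2}]$, where $k$ is a field. Let $f_1=x_1+x_{3n+2}+x_2$, let $f_i=x_{3i-2}+x_{3i-3}+x_{3i-1}$ for $2\le i\le n$, and let $f_{n+1}=x_{3n}+x_{3n+1}+\sum_{i=1}^{n}x_{3i-1}$. Then the sequence $f_1,\ldots,f_{n+1}$ is an initially regular sequence on $R/I$ with respect to a term order $>$ such that $x_1>x_{3n+2}>x_2$ and $x_{3i-2}>x_{3i-3}>x_{3i-1}$ for all $2\le i\le n$.
   Context: Let $R$ be a polynomial ring over a field, $I$ a proper ideal of $R$, and $>$ a fixed term order; $\operatorname{in}_{>}(J)$ denotes the initial ideal of an ideal $J$ with respect to $>$. Set $I_1=\operatorname{in}_{>}(I)$. A sequence of nonconstant polynomials $f_1,\ldots,f_q$ is an initially regular sequence on $R/I$ (with respect to $>$) if for each $1\le i\le q$, $f_i$ is a regular element (nonzerodivisor) on $R/I_i$, where $I_i=\operatorname{in}_{>}(I_{i-1},f_{i-1})$ for $i\ge 2$ and $(I_{i-1},f_{i-1})$ is the ideal generated by $I_{i-1}$ and $f_{i-1}$. *)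

(* Defs.v *)
From HB Require Import structures.
From mathcomp Require Import all_boot all_order all_algebra.
From mathcomp Require Export mpoly.

Set Implicit Arguments.
Unset Strict Implicit.
Unset Printing Implicit Defensive.

Import GRing.Theory.
Local Open Scope ring_scope.

(* [le m1 m2] reads "m1 <= m2"; the order is an arbitrary one, unrelated to the
   degrevlex order that mpoly.v puts on 'X_{1..N}. *)
Record term_order (N : nat) (le : rel 'X_{1..N}) : Prop := TermOrder {
  term_order_refl  : reflexive le;
  term_order_anti  : antisymmetric le;
  term_order_trans : transitive le;
  term_order_total : total le;
  term_order_ge0   : forall m, le 0%MM m;
  term_order_add   : forall m m1 m2, le m1 m2 -> le (m1 + m)%MM (m2 + m)%MM
}.

Definition mon_gt (N : nat) (le : rel 'X_{1..N}) : rel 'X_{1..N} :=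
  fun m1 m2 => (m1 != m2) && le m2 m1.

Section Ideals.

Variables (k : fieldType) (N : nat).
Local Notation R := {mpoly k[N]}.

Definition ideal_gen (G : R -> Prop) : R -> Prop := fun p =>
  exists2 s : seq (R * R),
    (forall c, c \in s -> G c.2) & p = \sum_(c <- s) c.1 * c.2.

Definition is_init_mon (le : rel 'X_{1..N}) (p : R) (m : 'X_{1..N}) : Prop :=
  m \in msupp p /\ (forall m', m' \in msupp p -> le m' m).

(* The zero polynomial has no initial monomial, so only the nonzero elements of
   J contribute generators. *)
Definition init_ideal (le : rel 'X_{1..N}) (J : R -> Prop) : R -> Prop :=
  ideal_gen (fun q => exists p m, [/\ J p, is_init_mon le p m & q = 'X_[m]]).

Definition regular_mod (J : R -> Prop) (f : R) : Prop :=
  forall g, J (f * g) -> J g.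

Definition nonconstant (f : R) : Prop := forall c : k, f <> c%:MP.

(* With 0-based indices, [init_chain le I f i] is I_{i+1} and [f`_i] is
   f_{i+1}. *)
Fixpoint init_chain (le : rel 'X_{1..N}) (I : R -> Prop) (f : seq R) (i : nat)
    : R -> Prop :=
  if i is j.+1 then
    init_ideal le (ideal_gen (fun p => init_chain le I f j p \/ p = f`_j))
  else init_ideal le I.

Definition initially_regular (le : rel 'X_{1..N}) (I : R -> Prop) (f : seq R)
    : Prop :=
  forall i, (i < size f)%N ->
    nonconstant f`_i /\ regular_mod (init_chain le I f i) f`_i.

Definition edge_ideal (e : rel 'I_N) : R -> Prop :=
  ideal_gen (fun p => exists i j, e i j /\ p = 'X_i * 'X_j).

End Ideals.

(* A simple graph (hence the cycle) only for N >= 3; [ordS] is the successor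
   modulo N. *)
Definition cycle_graph (N : nat) : rel 'I_N :=
  fun i j => (j == ordS i) || (i == ordS j).

(* The variable x_j of the 1-based numbering x_1, ..., x_{N+1}, as a monomial
   and as a polynomial. *)
Definition xmon (N j : nat) : 'X_{1..N.+1} := U_(inord j.-1)%MM.
Definition xvar (k : fieldType) (N j : nat) : {mpoly k[N.+1]} := 'X_[xmon N j].

Lemma cycle_edge_idealE (k : fieldType) (N : nat) (p : {mpoly k[N.+1]}) :
  edge_ideal (@cycle_graph N.+1) p <->
  ideal_gen (fun q => (exists2 j, (1 <= j <= N)%N
                         & q = xvar k N j * xvar k N j.+1)
                      \/ q = xvar k N 1 * xvar k N N.+1) p.
Proof.
have step (i : 'I_N.+1) :
    (exists2 j, (1 <= j <= N)%N & 'X_i * 'X_(ordS i) = xvar k N j * xvar k N j.+1)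
    \/ 'X_i * 'X_(ordS i) = xvar k N 1 * xvar k N N.+1.
  have [ltiN | leNi] := ltnP i N.
    left; exists i.+1 => //; rewrite /xvar /xmon /= inord_val.
    suff -> : ordS i = inord i.+1 by [].
    by apply: val_inj; rewrite /= inordK ?modn_small.
  have eiN : i = N :> nat by apply/eqP; rewrite eqn_leq leNi -ltnS ltn_ord.
  right; rewrite mulrC /xvar /xmon /=; congr ('X_ _ * 'X_ _).
    by apply: val_inj; rewrite /= eiN modnn inordK.
  by apply: val_inj; rewrite /= eiN inordK.
split=> -[s sG ->]; exists s => // c /sG.
- case=> i [j [/orP[/eqP-> | /eqP->] ->]]; first exact: step.
  by rewrite mulrC; apply: step.
- case=> [[j /andP[j1 jN] ->] | ->].
    exists (inord j.-1), (inord j); split=> //; apply/orP; left.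
    apply/eqP/val_inj; case: j j1 jN => // j _ jN /=.
    by rewrite !inordK ?modn_small // ltnS ltnW.
  exists (inord 0), (inord N); split=> //; apply/orP; right.
  by apply/eqP/val_inj; rewrite /= !inordK // modnn.
Qed.

(* The number of variables 3n+2 is written [(3 * n).+2], i.e. N = (3 * n).+1 in
   [xvar]. *)
Definition cycle_seq (k : fieldType) (n i : nat) : {mpoly k[(3 * n).+2]} :=
  let x := xvar k (3 * n).+1 in
  if (i == 1)%N then x 1%N + x (3 * n + 2)%N + x 2%N
  else if (i <= n)%N then
    x (3 * i - 2)%N + x (3 * i - 3)%N + x (3 * i - 1)%N
  else x (3 * n)%N + x (3 * n + 1)%N + \sum_(1 <= j < n.+1) x (3 * j - 1)%N.

(* Main.v *)
From HB Require Import structures.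
Require Import Defs.
From mathcomp Require Import all_boot all_order all_algebra.
From mathcomp Require Import mpoly zify ring.

Set Implicit Arguments.
Unset Strict Implicit.
Unset Printing Implicit Defensive.

Import GRing.Theory.
Local Open Scope ring_scope.

(** All the ideals of the chain are monomial, so each is described by the set of
    its monomials, and two facts have to be established: what the successive
    initial ideals are, and why the next linear form is a nonzerodivisor.

    Write a_i = x_{3i-2}, b_i = x_{3i-3} (with b_1 = x_{3n+2}) and
    c_i = x_{3i-1} for the i-th star: the vertex a_i of the cycle and its two
    neighbours, so that f_i = a_i + b_i + c_i for i <= n. With c_0 = x_{3n+1}
    and b_{n+1} = x_{3n} the remaining edges of the cycle are the links
    c_{i-1} b_i for 1 <= i <= n+1 and the edge b_{n+1} c_0.

    Passing to the initial ideal of (I_i, f_i) changes the generators of the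
    i-th star only. Modulo f_i one has a = - b - c, hence ab and ac become
    b^2 + bc and bc + c^2, and together with the link b b' (b' = c_{i-1}) the
    last one gives c^2 b'. So the edges ab, ac are replaced by the generators
    a, b^2, bc, c^2 b' (init_star). That nothing else occurs is seen by duality
    instead of by reducing S-polynomials: for every monomial s outside the
    claimed ideal there is a linear form (star_form) which vanishes on the ideal
    (I_i, f_i), takes the value 1 at s, and vanishes at all monomials that are
    not >= s. A polynomial with initial monomial s cannot be in the kernel of
    such a form (not_init_mon_dual).

    For regularity (regular_mod_sum_vars) a sum of distinct variables is a
    nonzerodivisor modulo a monomial ideal M as soon as every monomial m outside
    M can be multiplied by arbitrary powers of one of these variables without
    entering M: such a sum is then monic in a variable which is free modulo the
    localisation of M at that variable. For f_i one takes a variable of the star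
    that divides m, or a_i if there is none (star_regular). For f_{n+1} one
    takes the first c_j that divides m, or b_{n+1} if there is none
    (last_regular): the only generator which is not squarefree in c_j is
    c_j^2 c_{j-1}, and c_{j-1} does not divide m. *)

(** * Monomial ideals and initial ideals *)

Section MonomialIdeals.

Variables (k : fieldType) (N : nat).
Local Notation R := {mpoly k[N]}.
Local Notation mon := 'X_{1..N}.
Implicit Types (M : pred mon) (p q f g : R) (m u : mon) (J : R -> Prop).

Definition up_closed M := forall m u, M m -> M (m + u)%MM.

(** A monomial ideal is encoded by the predicate M of the monomials it contains:
    this keeps membership decidable and stable under reordering generators. *)
Definition mon_ideal M p := all M (msupp p).

Lemma mon_idealX M m : mon_ideal M 'X_[m] = M m.
Proof. by rewrite /mon_ideal msuppX /= andbT. Qed.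

Lemma mon_ideal_sum M (I : eqType) (s : seq I) (F : I -> R) :
  (forall i, i \in s -> mon_ideal M (F i)) -> mon_ideal M (\sum_(i <- s) F i).
Proof.
move=> MF; apply/allP=> m /msupp_sum_le /flattenP [t /mapP[i]].
by rewrite mem_filter => /= is_ -> /(allP (MF i is_)).
Qed.

Lemma mon_idealMl M p q :
  up_closed M -> mon_ideal M q -> mon_ideal M (p * q).
Proof.
move=> upM /allP Mq; apply/allP=> m /msuppM_le /allpairsP[[u v] /= [_ vq ->]].
by rewrite addmC; apply/upM/Mq.
Qed.

Lemma mem_ideal_gen (G : R -> Prop) q : G q -> ideal_gen G q.
Proof.
move=> Gq; exists [:: (1, q)]; last by rewrite big_seq1 mul1r.
by move=> c; rewrite inE => /eqP->.
Qed.

Lemma ideal_genD (G : R -> Prop) p q :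
  ideal_gen G p -> ideal_gen G q -> ideal_gen G (p + q).
Proof.
case=> s sG -> [t tG ->]; exists (s ++ t); last by rewrite big_cat.
by move=> c; rewrite mem_cat => /orP[/sG | /tG].
Qed.

Lemma ideal_genMl (G : R -> Prop) p q : ideal_gen G q -> ideal_gen G (p * q).
Proof.
case=> s sG ->; exists [seq (p * c.1, c.2) | c <- s].
  by move=> _ /mapP[c /sG cG ->].
by rewrite big_map mulr_sumr; apply: eq_bigr => c _ /=; rewrite mulrA.
Qed.

(** The initial ideal is spanned by the initial monomials, so that it suffices to
    determine those. *)
Lemma init_mon_idealP (le : rel mon) J M :
    up_closed M ->
    (forall p m, J p -> is_init_mon le p m -> M m) ->
    (forall m, M m -> exists2 p, J p & is_init_mon le p m) ->
  forall p, init_ideal le J p <-> mon_ideal M p.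
Proof.
move=> upM JM MJ p; split=> [[s sG ->] | /allP Mp].
  apply: mon_ideal_sum => c /sG [q [m [Jq qm ->]]].
  by apply: mon_idealMl; rewrite ?mon_idealX //; apply: JM qm.
exists [seq ((p@_m)%:MP, 'X_[m]) | m <- msupp p].
  by move=> _ /mapP[m /Mp /MJ[q Jq qm] ->]; exists q, m.
by rewrite big_map {1}[p]mpolyE; apply: eq_bigr => m _; rewrite mul_mpolyC.
Qed.

Lemma init_mon_dominant (le : rel mon) m q : term_order le ->
  {in msupp q, forall m', mon_gt le m m'} -> is_init_mon le ('X_[m] + q) m.
Proof.
move=> le_to mq; split=> [|m' /msuppD_le].
  rewrite mcoeff_msupp mcoeffD mcoeffX eqxx [q@_m]memN_msupp_eq0 ?addr0 ?oner_eq0 //.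
  by apply/negP=> /mq; rewrite /mon_gt eqxx.
rewrite mem_cat msuppX inE => /orP[/eqP-> | /mq/andP[]//].
exact: (term_order_refl le_to).
Qed.

Lemma mcoeff_mulXl m p v : (m <= v)%MM -> ('X_[m] * p)@_v = p@_(v - m).
Proof. by move=> le_mv; rewrite mulrC -{1}(submK le_mv) addmC mcoeffMX. Qed.

(** Call m free along x when no power of x brings m into M. If x is free for
    some m in the support of g, take such an m with the highest exponent of x.
    The coefficient of x m in f g must be zero since x m is outside M, so the
    term m x of the product is cancelled by some y m' with m' = m x / y in the
    support of g; then m' is again free along x, with a higher exponent of x.
    The induction is on the room left by the degree of g. *)
Lemma regular_mod_sum_vars M (S : seq 'I_N) :
    up_closed M -> uniq S ->
    (forall m, ~~ M m ->
       exists2 x, x \in S & forall t, ~~ M (m + U_(x) *+ t)%MM) ->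
  regular_mod (mon_ideal M) (\sum_(x <- S) 'X_x).
Proof.
move=> upM uS freeM g Mfg; apply/allP=> m0 gm0; apply/negPn/negP=> /freeM.
case=> x xS; move: gm0.
have [d] := ubnP (msize g - m0 x); elim: d m0 => // d IH m led gm free_m.
have NMxm : ~~ M (U_(x) + m)%MM by have:= free_m 1%N; rewrite mulm1n addmC.
have : (\sum_(y <- S) 'X_y * g)@_(U_(x) + m) = 0.
  rewrite -mulr_suml; apply: memN_msupp_eq0.
  by apply: contra NMxm => /(allP Mfg).
rewrite (bigD1_seq x) //= mcoeffD mcoeff_mulXl ?lem_addr // addmC addmK raddf_sum /=.
have [/hasP[y yS /andP[yx gy]] | /hasPn noy] :=
    boolP (has (fun y => (y != x) && (('X_y * g)@_(m + U_(x)) != 0)) S).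
  move=> _; move: gy; rewrite mulrC -mcoeff_msupp (perm_mem (msuppMX _ _)).
  case/mapP=> m' gm' Em; apply: (IH m') => //.
    have := congr1 (fun w : mon => w x) Em.
    have := msize_mdeg_lt gm'; rewrite mdegE (bigD1 x) //= !mnmDE !mnm1E eqxx.
    by rewrite (negbTE yx) => /= *; move: led; lia.
  move=> t; apply: contra (free_m t.+1) => /(upM _ U_(y)%MM).
  suff -> : (m' + U_(x) *+ t + U_(y))%MM = (m + U_(x) *+ t.+1)%MM by [].
  by rewrite mulmS addmA Em; apply/mnmP=> i; rewrite !mnmDE; lia.
rewrite big1_seq => [|y /andP[yx yS]].
  by rewrite addr0 => /eqP; rewrite mcoeff_eq0 gm.
by move: (noy y yS); rewrite yx negbK => /eqP.
Qed.

Definition mon_form (F : mon -> k) p : k := \sum_(m <- msupp p) p@_m * F m.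

Lemma mon_formE F p (s : seq mon) : uniq s -> {subset msupp p <= s} ->
  mon_form F p = \sum_(m <- s) p@_m * F m.
Proof.
move=> us ps; rewrite (bigID (mem (msupp p))) /= addrC big1 => [|m]; last first.
  by move/memN_msupp_eq0->; rewrite mul0r.
rewrite add0r -big_filter; apply/perm_big/uniq_perm; rewrite ?filter_uniq //.
by move=> m; rewrite mem_filter andb_idr //; apply: ps.
Qed.

Lemma mon_form_is_linear F : linear_for *%R (mon_form F).
Proof.
move=> c p q; pose s := undup (msupp (c *: p + q) ++ msupp p ++ msupp q).
have mem_s r : {subset msupp r <= msupp (c *: p + q) ++ msupp p ++ msupp q} ->
    mon_form F r = \sum_(m <- s) r@_m * F m.
  by move=> rs; apply: mon_formE => [|m /rs]; rewrite ?undup_uniq ?mem_undup.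
rewrite !mem_s => [|m|m|m]; try by rewrite !mem_cat => ->; rewrite ?orbT.
rewrite mulr_sumr -big_split; apply: eq_bigr => m _.
by rewrite /= mcoeffD mcoeffZ mulrDl mulrA.
Qed.

HB.instance Definition _ F :=
  GRing.isLinear.Build k R k *%R (mon_form F) (mon_form_is_linear F).

Lemma mon_formX F m : mon_form F 'X_[m] = F m.
Proof. by rewrite /mon_form msuppX big_seq1 mcoeffX eqxx mul1r. Qed.

(** A polynomial p with initial monomial s is a combination of s, with nonzero
    coefficient, and of monomials below s, at which the form vanishes. Hence the
    form does not vanish at p. *)
Lemma not_init_mon_dual (le : rel mon) (G : R -> Prop) F s p :
    term_order le ->
    (forall m g, G g -> mon_form F ('X_[m] * g) = 0) ->
    F s != 0 -> (forall m, F m != 0 -> le s m) ->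
  ideal_gen G p -> ~ is_init_mon le p s.
Proof.
move=> le_to FG Fs F_le [t tG ->]; set p' := \sum_(c <- t) _ => -[sp s_max].
have Fp : mon_form F p' = 0.
  rewrite raddf_sum big1_seq // => c /andP[_ /tG Gc].
  rewrite {1}[c.1]mpolyE mulr_suml raddf_sum big1 // => m _.
  by rewrite -scalerAl /= linearZ /= FG ?mulr0.
move: Fp; rewrite /mon_form (bigD1_seq s) ?msupp_uniq //= big1_seq ?addr0.
  by move/eqP; rewrite mulf_eq0 (negbTE Fs) orbF mcoeff_eq0 sp.
move=> m /andP[m_s /s_max ms]; have [->|/F_le sm] := eqVneq (F m) 0.
  by rewrite mulr0.
by case/eqP: m_s; apply: (term_order_anti le_to); rewrite ms sm.
Qed.

End MonomialIdeals.

Lemma is_init_monMl (k : fieldType) (N : nat) (le : rel 'X_{1..N})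
    (p : {mpoly k[N]}) (m u : 'X_{1..N}) :
  term_order le -> is_init_mon le p m -> is_init_mon le ('X_[u] * p) (u + m)%MM.
Proof.
move=> le_to [pm max_m]; rewrite mulrC.
split=> [|v]; rewrite (perm_mem (msuppMX _ _)).
  by apply/mapP; exists m.
case/mapP=> w /max_m wm ->; rewrite ![(u + _)%MM]addmC.
exact: (term_order_add le_to).
Qed.

Lemma is_init_monX (k : fieldType) (N : nat) (le : rel 'X_{1..N}) (m : 'X_{1..N}) :
  term_order le -> is_init_mon (k := k) le 'X_[m] m.
Proof.
by move=> le_to; rewrite -['X_[m]]addr0; apply: init_mon_dominant => // w; rewrite msupp0.
Qed.
Lemma nonconstant_sum_vars (k : fieldType) (N : nat) (S : seq 'I_N) :
  uniq S -> S != [::] -> nonconstant (\sum_(x <- S) ('X_x : {mpoly k[N]})).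
Proof.
case: S => [|x S] //= /andP[xS _] _ c /(congr1 (mcoeff U_(x))).
rewrite big_cons mcoeffD mcoeffXU eqxx raddf_sum /= big1_seq => [|y /andP[_ yS]].
  by rewrite mcoeffC mnm1_eq0 mulr0 addr0 => /eqP; rewrite oner_eq0.
by rewrite mcoeffXU; case: eqP => // yx; rewrite -yx yS in xS.
Qed.

Definition edge_mon (N : nat) (e : rel 'I_N) (m : 'X_{1..N}) : bool :=
  [exists i, [exists j, [&& e i j, 0 < m i & 0 < m j]]]%N.

(** Irreflexivity makes the two factors of a generator distinct variables, so
    that i and j dividing m gives x_i x_j dividing m. *)
Lemma init_edge_ideal (k : fieldType) (N : nat) (e : rel 'I_N)
    (le : rel 'X_{1..N}) : irreflexive e -> term_order le ->
  forall p : {mpoly k[N]},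
    init_ideal le (edge_ideal e) p <-> mon_ideal (edge_mon e) p.
Proof.
move=> e_irr le_to.
have edge_up : up_closed (edge_mon e).
  move=> m u /existsP[i /existsP[j /and3P[eij mi mj]]].
  by apply/existsP; exists i; apply/existsP; exists j; rewrite !mnmDE eij !addn_gt0 mi mj.
apply: init_mon_idealP => // [p m [s sE ->] [pm _] | m].
  suff /allP: mon_ideal (edge_mon e) (\sum_(c <- s) c.1 * c.2) by apply.
  apply: mon_ideal_sum => c /sE[i [j [eij ->]]].
  apply: mon_idealMl => //; rewrite -mpolyXD mon_idealX.
  apply/existsP; exists i; apply/existsP; exists j.
  by rewrite eij !mnmDE !mnm1E !eqxx addn1.
case/existsP=> i /existsP[j /and3P[eij mi mj]].
exists 'X_[m]; last exact: is_init_monX.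
have /submK <- : (U_(i) + U_(j) <= m)%MM.
  apply/mnm_lepP=> h; rewrite mnmDE !mnm1E.
  case: (eqVneq i h) => [<- | _]; last by case: eqVneq => [<-|].
  by case: eqVneq => [ji | _]; first by rewrite ji e_irr in eij.
rewrite mpolyXD; apply/ideal_genMl/mem_ideal_gen; exists i, j.
by rewrite mpolyXD.
Qed.

Lemma regular_mod_iff (k : fieldType) (N : nat) (J J' : {mpoly k[N]} -> Prop) f :
  (forall p, J p <-> J' p) -> regular_mod J' f -> regular_mod J f.
Proof. by move=> JJ' reg g /JJ' /reg /JJ'. Qed.

(** * Adjoining the linear form of a star *)

Section StarStep.

Variables (k : fieldType) (N : nat).
Local Notation R := {mpoly k[N]}.
Local Notation mon := 'X_{1..N}.
Implicit Types (p q f g : R) (m u s : mon).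

(** The star has centre a and leaves b, c; the vertices b' and c' are the other
    neighbours of b and c. All generators that do not involve the star are
    collected in K, which is why only exponents outside {a, b, c} matter to
    it. *)
Variables (a b c b' c' : 'I_N) (K : pred mon).

Definition star_mon m :=
  [|| (0 < m a) && ((0 < m b) || (0 < m c)),
      (0 < m b) && (0 < m b'), (0 < m c) && (0 < m c') | K m]%N.

(** The edges at a disappear; a, b^2, bc and c^2 b' are the new generators. *)
Definition star_init_mon m :=
  [|| 0 < m a, 1 < m b, (0 < m b) && (0 < m c), (1 < m c) && (0 < m b'),
      (0 < m b) && (0 < m b'), (0 < m c) && (0 < m c') | K m]%N.

Lemma star_mon_up : up_closed K -> up_closed star_mon.
Proof.
move=> K_up m u; rewrite /star_mon !mnmDE.
have := @K_up m u; case: (K m) => [-> //|_]; lia.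
Qed.

Lemma star_init_mon_up : up_closed K -> up_closed star_init_mon.
Proof.
move=> K_up m u; rewrite /star_init_mon !mnmDE.
have := @K_up m u; case: (K m) => [-> //|_]; lia.
Qed.

Hypothesis uniq_abc : uniq [:: a; b; c].
Hypotheses (b'_out : b' \notin [:: a; b; c]) (c'_out : c' \notin [:: a; b; c]).
Hypothesis K_up : up_closed K.
Hypothesis K_out :
  forall m m', (forall i, i \notin [:: a; b; c] -> m i = m' i) -> K m = K m'.

Let neqs : (((a == b) = false) * ((b == a) = false) * ((a == c) = false)
  * ((c == a) = false) * ((b == c) = false) * ((c == b) = false))
  * (((a == b') = false) * ((b == b') = false) * ((c == b') = false)
  * ((a == c') = false) * ((b == c') = false) * ((c == c') = false)).
Proof.
move: uniq_abc b'_out c'_out; rewrite /= !inE !negb_or andbT !(eq_sym b') !(eq_sym c').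
case/andP=> /andP[/negbTE ab /negbTE ac] /negbTE bc.
case/and3P=> /negbTE ab' /negbTE bb' /negbTE cb'.
case/and3P=> /negbTE ac' /negbTE bc' /negbTE cc'.
by rewrite !(eq_sym b a) !(eq_sym c a) !(eq_sym c b) ab ac bc ab' bb' cb' ac' bc' cc'.
Qed.

Let expE := (@mnmDE N, @mulmnE N, @mnm1E N, eqxx (T := 'I_N), neqs, mul1n, mul0n).

Lemma mnm1_out x i : i \notin [:: a; b; c] -> x \in [:: a; b; c] -> U_(x)%MM i = 0%N.
Proof. by rewrite mnm1E; case: eqVneq => // -> /negP. Qed.

Lemma K_add_abc m x t : x \in [:: a; b; c] -> K (m + U_(x) *+ t)%MM = K m.
Proof.
move=> x_abc; apply: K_out => i i_out.
by rewrite mnmDE mulmnE mnm1_out // mul0n addn0.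
Qed.

Let f : R := 'X_a + 'X_b + 'X_c.

(** A variable of the star dividing m can be raised to any power since the
    generators are squarefree in a, b and c. When b and c do not divide m, the
    centre a can be used, as all generators at a are ab and ac. *)
Lemma star_regular : regular_mod (mon_ideal star_mon) f.
Proof.
have -> : f = \sum_(x <- [:: a; b; c]) 'X_x.
  by rewrite !big_cons big_nil addr0 addrA.
apply: regular_mod_sum_vars => //; first exact: star_mon_up.
move=> m Mm.
have [mb | mb] := posnP (m b); last first.
  exists b => [|t]; first by rewrite !inE eqxx orbT.
  by move: Mm; rewrite /star_mon K_add_abc ?inE ?eqxx ?orbT // !expE; lia.
have [mc | mc] := posnP (m c); last first.
  exists c => [|t]; first by rewrite !inE eqxx !orbT.
  by move: Mm; rewrite /star_mon K_add_abc ?inE ?eqxx ?orbT // !expE; lia.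
exists a => [|t]; first by rewrite !inE eqxx.
by move: Mm; rewrite /star_mon K_add_abc ?inE ?eqxx ?orbT // !expE; lia.
Qed.

(** The degree in the star variables; the relation a = - b - c and its
    consequences are homogeneous for it. *)
Definition star_deg m := (m a + m b + m c)%N.

(** The coefficient of s in the normal form of m, for a standard monomial s.
    Rewriting a to - b - c and then using b^2 = c^2 = - bc, a monomial
    a^l b^i c^j of degree t >= 2 reduces to 0 if l > 0 (a b and a c vanish, and so
    does a^2 = a f - ab - ac) and to (-1)^i c^t otherwise. In degree 1 the
    leaves b and c are already reduced. The standard monomials of degree at
    least 2 are thus c^t times a monomial outside the star, and the first case
    distinction only compares the data that reduction preserves. *)
Definition star_form s m : k :=
  if (star_deg m == star_deg s)
     && [forall i, (i \notin [:: a; b; c]) ==> (m i == s i)]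
  then if (star_deg m <= 1)%N then if (0 < m a)%N then -1 else (m == s)%:R
       else if (0 < m a)%N then 0 else (-1) ^+ m b
  else 0.

Lemma star_form_self s : ~~ star_init_mon s -> star_form s s = 1.
Proof.
rewrite /star_form /star_init_mon /star_deg eqxx => s_std.
have -> /= : [forall i, (i \notin [:: a; b; c]) ==> (s i == s i)].
  by apply/forallP=> i; rewrite eqxx implybT.
have sa : s a = 0%N by lia.
have [sb | sb] : s b = 0%N \/ (s b = 1%N /\ s c = 0%N) by lia.
  by rewrite sa sb eqxx expr0; case: ifP.
by rewrite sa sb.1 sb.2 eqxx.
Qed.

(** The reduction keeps the part of m outside the star, so generators in K, bb'
    or cc' dividing m lead to a generator dividing s; here bb' in degree at
    least 2 needs c^2 b'. *)
Lemma star_form_ideal s m :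
  ~~ star_init_mon s -> star_mon m -> star_form s m = 0.
Proof.
move=> s_std Mm; rewrite /star_form; case: ifP => // /andP[/eqP deg_m /forallP out_m].
have out_eq i : i \notin [:: a; b; c] -> m i = s i.
  by move=> i_out; apply/eqP; move: (out_m i); rewrite i_out.
have := K_out out_eq; have := out_eq _ b'_out; have := out_eq _ c'_out.
move: deg_m s_std Mm; rewrite /star_mon /star_init_mon /star_deg.
case: ifP => [deg1 | deg2].
  case: ifP => [ma | ma]; first by case: (K m); case: (K s); lia.
  have [-> | _ _ _ //] := eqVneq m s; case: (K s); lia.
case: ifP => [// | ma]; case: (K m); case: (K s); lia.
Qed.

(** The form vanishes on m (a + b + c): in degree at least 2 the terms from b
    and c have opposite signs unless a divides m and all terms are 0, and in degree 1 the value -1 at m a cancels the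
    value 1 taken at the one of m b, m c which is s. *)
Lemma star_form_sum s m : ~~ star_init_mon s ->
  star_form s (m + U_(a)) + star_form s (m + U_(b)) + star_form s (m + U_(c)) = 0.
Proof.
move=> s_std.
have deg_m x : x \in [:: a; b; c] -> star_deg (m + U_(x))%MM = (star_deg m).+1.
  by rewrite /star_deg !inE => /or3P[] /eqP->; rewrite !expE; lia.
have out_m x : x \in [:: a; b; c] ->
    [forall i, (i \notin [:: a; b; c]) ==> ((m + U_(x))%MM i == s i)]
      = [forall i, (i \notin [:: a; b; c]) ==> (m i == s i)].
  move=> x_abc; apply: eq_forallb => i; case: (boolP (i \in _)) => //= i_out.
  by rewrite mnmDE mnm1_out ?addn0.
rewrite /star_form !deg_m ?out_m ?inE ?eqxx ?orbT //.
case: ifP => [/andP[/eqP deg_s /forallP m_s] | _]; last by rewrite !addr0.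
rewrite !expE !addn0 addn1 ltn0Sn ltnS.
have [deg0 | deg1] := posnP (star_deg m); last first.
  case: posnP => [ma | ma]; last by rewrite leqNgt deg1 /= !addr0.
  rewrite leqNgt deg1 /=.
  by rewrite add0r addn1 exprS mulN1r addNr.
have [ma mb mc] : [/\ m a = 0, m b = 0 & m c = 0]%N.
  by move: deg0; rewrite /star_deg; split; lia.
have s_eq x : x \in [:: a; b; c] -> (m + U_(x) == s)%MM = (s x == 1%N).
  move=> x_abc; apply/eqP/eqP=> [<- | sx].
    by move: x_abc; rewrite !inE => /or3P[] /eqP->; rewrite !expE ?ma ?mb ?mc.
  apply/mnmP=> i; rewrite mnmDE mnm1E.
  have [i_abc | i_out] := boolP (i \in [:: a; b; c]); last first.
    by have := m_s i; rewrite i_out -mnm1E mnm1_out ?addn0 // => /eqP.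
  move: deg_s deg0 sx; rewrite /star_deg.
  by move: x_abc i_abc; rewrite !inE => /or3P[] /eqP-> /or3P[] /eqP->; rewrite !expE; lia.
rewrite deg0 ma !s_eq ?inE ?eqxx ?orbT //.
have: ((s b == 1) + (s c == 1) = 1)%N.
  by move: deg_s s_std; rewrite /star_deg /star_init_mon; lia.
by case: (s b == _); case: (s c == _) => //= _; rewrite ?addr0 addNr.
Qed.

Variable le : rel mon.
Hypothesis le_to : term_order le.
Hypotheses (gt_ab : mon_gt le U_(a)%MM U_(b)%MM) (gt_bc : mon_gt le U_(b)%MM U_(c)%MM).

(** The comparison needed for the reduction of b^i c^j to c^(i+j). *)
Lemma le_exchange_cb m t : le (m + U_(c) *+ t)%MM (m + U_(b) *+ t)%MM.
Proof.
case/andP: gt_bc => _ le_cb; elim: t m => [|t IH] m.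
  exact: (term_order_refl le_to).
rewrite !mulmS !addmA; apply: (term_order_trans le_to) (IH (m + U_(b))%MM).
rewrite -![(m + _ + _)%MM]addmA ![(m + (_ + _))%MM]addmC.
rewrite -![(_ + _ + m)%MM]addmA.
exact: (term_order_add le_to).
Qed.

Lemma star_form_le s m : ~~ star_init_mon s -> star_form s m != 0 -> le s m.
Proof.
move=> s_std; rewrite /star_form; case: ifP => [|_]; last by rewrite eqxx.
case/andP=> /eqP deg_m /forallP out_m.
have out_eq i : i \notin [:: a; b; c] -> m i = s i.
  by move=> i_out; apply/eqP; move: (out_m i); rewrite i_out.
(* Monomials are compared on the star and off it separately. *)
have eqm (v w : mon) : v a = w a -> v b = w b -> v c = w c ->
    (forall i, i \notin [:: a; b; c] -> v i = w i) -> v = w.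
  move=> ea eb ec eo; apply/mnmP=> i.
  have [|/eo//] := boolP (i \in [:: a; b; c]).
  by rewrite !inE => /or3P[] /eqP->.
case: ifP => deg1.
  case: ifP => [ma _ | _]; last first.
    have [-> _ | _] := eqVneq m s; last by rewrite eqxx.
    exact: (term_order_refl le_to).
  have [ma1 mb0 mc0] : [/\ m a = 1, m b = 0 & m c = 0]%N.
    by move: deg1; rewrite /star_deg; split; lia.
  have m_a : m = (m - U_(a) + U_(a))%MM by rewrite submK // lep1mP -lt0n.
  (* In degree 1 with m = a w, the standard monomial s is b w or c w. *)
  have lex x : x \in [:: a; b; c] -> le U_(x)%MM U_(a)%MM ->
      s a = U_(x)%MM a -> s b = U_(x)%MM b -> s c = U_(x)%MM c -> le s m.
    move=> x_abc xa xsa xsb xsc; have -> : s = (m - U_(a) + U_(x))%MM.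
      apply: eqm => [|||i i_out].
      1-3: by rewrite !(mnmDE, mnmBE) ?xsa ?xsb ?xsc ?ma1 ?mb0 ?mc0 !expE.
      by rewrite mnmDE mnmBE !mnm1_out ?subn0 ?addn0 ?out_eq // !inE eqxx.
    rewrite [X in le _ X]m_a ![(m - _ + _)%MM]addmC.
    exact: (term_order_add le_to).
  have leba : le U_(b)%MM U_(a)%MM by case/andP: gt_ab.
  have lecb : le U_(c)%MM U_(b)%MM by case/andP: gt_bc.
  have [sb | sb] := posnP (s b).
    apply: (lex c); rewrite ?inE ?eqxx ?orbT ?expE //; last 1 first.
    - by move: s_std deg_m deg1 ma; rewrite /star_deg /star_init_mon; lia.
    - exact: (term_order_trans le_to) leba.
    - by move: s_std; rewrite /star_init_mon; lia.
  by apply: (lex b); rewrite ?inE ?eqxx ?orbT ?expE //;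
    move: s_std deg_m deg1 ma; rewrite /star_deg /star_init_mon; lia.
case: ifP => [_ | ma _]; first by rewrite eqxx.
have [sa sb] : s a = 0%N /\ s b = 0%N.
  by move: s_std deg_m deg1; rewrite /star_deg /star_init_mon; lia.
(* In degree at least 2, s is obtained from m by exchanging every b for c. *)
pose w := (m - U_(b) *+ m b)%MM.
have -> : s = (w + U_(c) *+ m b)%MM.
  apply: eqm => [|||i i_out].
  1-3: rewrite !(expE, mnmBE) ?sa ?sb; move: deg_m ma; rewrite /star_deg; lia.
  rewrite mnmDE mnmBE !mulmnE out_eq //.
  by rewrite !(mnm1_out i_out) ?inE ?eqxx ?orbT // mul0n subn0 addn0.
suff {2}-> : m = (w + U_(b) *+ m b)%MM by apply: le_exchange_cb.
rewrite submK //; apply/mnm_lepP=> i; rewrite !expE.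
by case: eqVneq => [<-|_]; rewrite ?mul1n.
Qed.

Lemma mon_form_ideal s p :
  ~~ star_init_mon s -> mon_ideal star_mon p -> mon_form (star_form s) p = 0.
Proof.
move=> s_std /allP Mp; rewrite /mon_form big1_seq // => m /andP[_ /Mp Mm].
by rewrite star_form_ideal ?mulr0.
Qed.

(** One inclusion is the duality argument with star_form. For the other, elements
    with the required initial monomials are f for a, b f - ab for b^2, c f - ac
    for bc, and b' (c f - ac) - c (bb') = c^2 b'. *)
Lemma init_star (J : R -> Prop) : (forall p, J p <-> mon_ideal star_mon p) ->
  forall p, init_ideal le (ideal_gen (fun q => J q \/ q = f)) p
            <-> mon_ideal star_init_mon p.
Proof.
move=> JE; set Jf := ideal_gen _.
have XJf m : star_mon m -> Jf 'X_[m].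
  by move=> Mm; apply: mem_ideal_gen; left; apply/JE; rewrite mon_idealX.
have fJf : Jf f by apply: mem_ideal_gen; right.
apply: init_mon_idealP => [|p s Jp ps|m Mm]; first exact: star_init_mon_up.
  apply/negPn/negP=> s_std; move: ps.
  apply: (not_init_mon_dual le_to (F := star_form s)) Jp => [m g||m].
  - case=> [/JE Jg | ->].
      by apply: mon_form_ideal => //; apply: mon_idealMl => //; apply: star_mon_up.
    by rewrite !mulrDr -!mpolyXD !raddfD /= !mon_formX star_form_sum.
  - by rewrite star_form_self ?oner_eq0.
  - exact: star_form_le.
suff [p [u [Jp pu um]]] : exists p u, [/\ Jf p, is_init_mon le p u & (u <= m)%MM].
  exists ('X_[m - u] * p); first exact: ideal_genMl.
  by rewrite -{2}(submK um); apply: is_init_monMl.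
have lem2 x y : x != y -> (0 < m x)%N -> (0 < m y)%N -> (U_(x) + U_(y) <= m)%MM.
  move=> xy mx my; apply/mnm_lepP=> i; rewrite mnmDE !mnm1E.
  by case: eqVneq => [<- | _]; [rewrite eq_sym (negbTE xy) | case: eqVneq => [<-|]].
have [Km | Mm'] := boolP (star_mon m).
  by exists 'X_[m], m; split; [exact: XJf | exact: is_init_monX | exact: lepm_refl].
have gt_add u v w : mon_gt le u v -> mon_gt le (u + w)%MM (v + w)%MM.
  by case/andP=> uv vu; rewrite /mon_gt eqm_add2r uv (term_order_add le_to).
have init2 u v : mon_gt le u v -> is_init_mon (k := k) le ('X_[u] + 'X_[v]) u.
  move=> uv; apply: init_mon_dominant => // w; rewrite msuppX inE => /eqP->.
  exact: uv.
have JfXf x : star_mon (U_(a) + U_(x))%MM -> Jf ('X_x * f - 'X_a * 'X_x).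
  move=> Max; apply: ideal_genD; first exact: ideal_genMl.
  by rewrite -mulN1r -mpolyXD; apply/ideal_genMl/XJf.
have [ma | ma] := posnP (m a); last first.
  exists f, U_(a)%MM; split=> //; last by rewrite lep1mP -lt0n.
  rewrite /f -addrA; apply: init_mon_dominant => // w /msuppD_le.
  rewrite mem_cat !msuppX !inE => /orP[] /eqP-> //.
  case/andP: gt_bc => bc le_cb; case/andP: gt_ab => ab le_ba.
  rewrite /mon_gt (term_order_trans le_to le_cb le_ba) andbT.
  by apply/eqP=> /(congr1 (fun u : mon => u a)); rewrite !expE.
have Mab : star_mon (U_(a) + U_(b))%MM by rewrite /star_mon !expE.
have Mac : star_mon (U_(a) + U_(c))%MM by rewrite /star_mon !expE.
have Mbb' : star_mon (U_(b) + U_(b'))%MM by apply/or4P/Or42; rewrite !mnmDE !mnm1E !eqxx addn1.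
have Eb : 'X_b * f - 'X_a * 'X_b = 'X_[U_(b) + U_(b)] + 'X_[U_(c) + U_(b)].
  by rewrite /f !mpolyXD; ring.
have Ec : 'X_c * f - 'X_a * 'X_c = 'X_[U_(b) + U_(c)] + 'X_[U_(c) + U_(c)].
  by rewrite /f !mpolyXD; ring.
have [mb | mb] := ltnP 1 (m b).
  exists ('X_b * f - 'X_a * 'X_b), (U_(b) + U_(b))%MM; split; first exact: JfXf.
    by rewrite Eb; apply/init2/gt_add.
  apply/mnm_lepP=> i; rewrite mnmDE !mnm1E.
  by case: eqVneq => // <-.
have [/andP[mb0 mc] | mbc] := boolP ((0 < m b) && (0 < m c))%N.
  exists ('X_c * f - 'X_a * 'X_c), (U_(b) + U_(c))%MM; split; first exact: JfXf.
    by rewrite Ec; apply/init2/gt_add.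
  by apply: lem2 => //; rewrite neqs.
exists 'X_[U_(c) + U_(c) + U_(b')], (U_(c) + U_(c) + U_(b'))%MM.
split; last 1 first.
- move: Mm Mm'; rewrite /star_init_mon /star_mon => Mm Mm'.
  have [mc mb'] : (1 < m c)%N /\ (0 < m b')%N by case: (K m) Mm Mm'; lia.
  apply/mnm_lepP=> i; rewrite !mnmDE !mnm1E.
  by case: eqVneq => [<- | _]; [rewrite eq_sym neqs | case: eqVneq => [<-|]].
- have -> : 'X_[U_(c) + U_(c) + U_(b')]
      = 'X_b' * ('X_c * f - 'X_a * 'X_c) + - 'X_c * 'X_[U_(b) + U_(b')] :> R.
    by rewrite /f !mpolyXD; ring.
  by apply: ideal_genD; apply: ideal_genMl; [exact: JfXf | exact: XJf].
- exact: is_init_monX.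
Qed.

End StarStep.

(** * The cycle as a chain of stars *)

Section Cycle.

Variable n : nat.
Hypothesis n_gt0 : (0 < n)%N.
Local Notation mon := 'X_{1..(3 * n).+2}.
Implicit Types (m : mon) (i j t : nat).

(** Star i consists of a_i, b_i, c_i. The out-of-pattern values b_1 = x_{3n+2}
    and c_0 = x_{3n+1} close the cycle: with them c_{i-1} is the outer neighbour
    of b_i, and b_{i+1} that of c_i, for all stars alike. Indices are shifted by
    one because ordinals start at 0. *)
Definition center i : 'I_(3 * n).+2 := inord (3 * i - 3)%N.
Definition left_leaf i : 'I_(3 * n).+2 :=
  inord (if i == 1 then 3 * n + 1 else 3 * i - 4)%N.
Definition right_leaf i : 'I_(3 * n).+2 :=
  inord (if i == 0 then 3 * n else 3 * i - 2)%N.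

Local Notation A := center.
Local Notation B := left_leaf.
Local Notation C := right_leaf.

Lemma val_center i : (0 < i <= n)%N -> A i = (3 * i - 3)%N :> nat.
Proof. by move=> i_n; rewrite inordK //; lia. Qed.

Lemma val_left i : (0 < i <= n.+1)%N ->
  B i = (if i == 1 then 3 * n + 1 else 3 * i - 4)%N :> nat.
Proof. by move=> i_n; rewrite inordK //; case: eqP; lia. Qed.

Lemma val_right i : (i <= n)%N ->
  C i = (if i == 0 then 3 * n else 3 * i - 2)%N :> nat.
Proof. by move=> i_n; rewrite inordK //; case: eqP; lia. Qed.

Lemma center_eq i j : (0 < i <= n)%N -> (0 < j <= n)%N -> (A i == A j) = (i == j).
Proof. by move=> i_n j_n; rewrite -val_eqE /= !val_center //; lia. Qed.

Lemma left_eq i j : (0 < i <= n.+1)%N -> (0 < j <= n.+1)%N -> (B i == B j) = (i == j).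
Proof.
by move=> i_n j_n; rewrite -val_eqE /= !val_left //; case: (i =P _); case: (j =P _); lia.
Qed.

Lemma right_eq i j : (i <= n)%N -> (j <= n)%N -> (C i == C j) = (i == j).
Proof.
by move=> i_n j_n; rewrite -val_eqE /= !val_right //; case: (i =P _); case: (j =P _); lia.
Qed.

Lemma center_left i j : (0 < i <= n)%N -> (0 < j <= n.+1)%N -> (A i == B j) = false.
Proof.
by move=> i_n j_n; rewrite -val_eqE /= val_center // val_left //; case: (j =P _); lia.
Qed.

Lemma center_right i j : (0 < i <= n)%N -> (j <= n)%N -> (A i == C j) = false.
Proof.
by move=> i_n j_n; rewrite -val_eqE /= val_center // val_right //; case: (j =P _); lia.
Qed.

Lemma left_right i j : (0 < i <= n.+1)%N -> (j <= n)%N -> (B i == C j) = false.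
Proof.
move=> i_n j_n; rewrite -val_eqE /= val_left // val_right //.
by case: (i =P _); case: (j =P _); lia.
Qed.

(** The generators of star i once the linear forms of the first t stars have
    been adjoined. *)
Definition star_part t m i : bool :=
  (if i <= t
   then [|| 0 < m (A i), 1 < m (B i), (0 < m (B i)) && (0 < m (C i))
          | (1 < m (C i)) && (0 < m (C i.-1))]
   else (0 < m (A i)) && ((0 < m (B i)) || (0 < m (C i))))%N.

Definition link_part m i : bool := ((0 < m (B i)) && (0 < m (C i.-1)))%N.

Definition cycle_mon t m : bool :=
  [|| has (star_part t m) (iota 1 n), has (link_part m) (iota 1 n.+1)
    | (0 < m (B n.+1)) && (0 < m (C 0))]%N.

(** The generators free of the variables of star i, hence without its two links.
    Stars before i are in their final form. A star j < i contributes
    c_j^2 c_{j-1}, which avoids star i, whereas a processed star i.+1 would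
    contribute c_{i+1}^2 c_i. *)
Definition off_star i m : bool :=
  [|| has (fun j => (j != i) && star_part i m j) (iota 1 n),
      has (fun j => (j \notin [:: i; i.+1]) && link_part m j) (iota 1 n.+1)
    | (0 < m (B n.+1)) && (0 < m (C 0))]%N.

Lemma off_star_up i : up_closed (off_star i).
Proof.
move=> m u; case/or3P=> [/hasP[j jn /andP[ji mj]]|/hasP[j jn /andP[ji mj]]|mn].
- apply/or3P/Or31/hasP; exists j => //; rewrite ji /=.
  by move: mj; rewrite /star_part !mnmDE; case: ifP; lia.
- apply/or3P/Or32/hasP; exists j => //; rewrite ji /=.
  by move: mj; rewrite /link_part !mnmDE; lia.
- by apply/or3P/Or33; move: mn; rewrite !mnmDE; lia.
Qed.

Lemma off_star_out i m m' : (0 < i <= n)%N ->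
  (forall x, x \notin [:: A i; B i; C i] -> m x = m' x) ->
  off_star i m = off_star i m'.
Proof.
move=> i_n out.
have Aout j : (0 < j <= n)%N -> j != i -> m (A j) = m' (A j).
  move=> j_n ji; apply: out.
  by rewrite !inE center_eq // center_left ?center_right //; lia.
have Bout j : (0 < j <= n.+1)%N -> j != i -> m (B j) = m' (B j).
  move=> j_n ji; apply: out.
  by rewrite !inE eq_sym center_left ?left_eq // ?left_right //; lia.
have Cout j : (j <= n)%N -> j != i -> m (C j) = m' (C j).
  move=> j_n ji; apply: out.
  by rewrite !inE eq_sym center_right // eq_sym left_right ?right_eq //; lia.
congr [|| _, _ | _].
- apply: eq_in_has => j; rewrite mem_iota => j_n.
  have [//|ji] := eqVneq j i; rewrite /star_part; case: ifP => le_ji.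
    by rewrite Aout ?Bout // ?[m (C j)]Cout // ?Cout //; lia.
  by rewrite Aout ?Bout // ?Cout //; lia.
- apply: eq_in_has => j; rewrite mem_iota => j_n; rewrite !inE negb_or.
  have [//|ji] := eqVneq j i; have [//|ji1] := eqVneq j i.+1.
  by rewrite /link_part Bout ?Cout //; lia.
- by rewrite Bout ?Cout //; lia.
Qed.

Lemma has_split (T : eqType) (P : pred T) (s : seq T) x : x \in s ->
  has P s = P x || has (fun y => (y != x) && P y) s.
Proof.
move=> xs; apply/hasP/orP=> [[y ys Py] | [Px | /hasP[y ys /andP[_ Py]]]].
- have [<- | yx] := eqVneq y x; [by left | right; apply/hasP].
  by exists y => //; rewrite yx.
- by exists x.
- by exists y.
Qed.

Lemma has_link i m : (0 < i <= n)%N ->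
  has (link_part m) (iota 1 n.+1)
    = [|| link_part m i, link_part m i.+1
        | has (fun j => (j \notin [:: i; i.+1]) && link_part m j) (iota 1 n.+1)].
Proof.
move=> i_n; rewrite (@has_split _ _ _ i) ?mem_iota; last lia.
rewrite (@has_split _ _ _ i.+1) ?mem_iota; last lia.
rewrite (_ : i.+1 != i) ?andTb; last lia.
by do 2![congr orb]; apply: eq_has => j; rewrite !inE negb_or andbA [_ && (j != i)]andbC.
Qed.

(** Before and after the i-th form is adjoined, the ideal has the shape treated
    for a single star, with the same outer part. *)
Lemma cycle_mon_star i m : (0 < i <= n)%N ->
  cycle_mon i.-1 m
    = star_mon (A i) (B i) (C i) (C i.-1) (B i.+1) (off_star i) m.
Proof.
move=> i_n; rewrite /cycle_mon (has_link _ i_n).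
rewrite (@has_split _ _ _ i) ?mem_iota; last lia.
rewrite {1}/star_part leqNgt (_ : (i.-1 < i)%N) /=; last lia.
rewrite /off_star /star_mon /link_part /=.
have -> : has (fun y => (y != i) && star_part i.-1 m y) (iota 1 n)
    = has (fun y => (y != i) && star_part i m y) (iota 1 n).
  apply: eq_has => j; have [//|ji] := eqVneq j i.
  by rewrite /star_part (_ : (j <= i.-1)%N = (j <= i)%N) //; lia.
by do ![case: has] => /=; lia.
Qed.

Lemma cycle_mon_star_init i m : (0 < i <= n)%N ->
  cycle_mon i m
    = star_init_mon (A i) (B i) (C i) (C i.-1) (B i.+1) (off_star i) m.
Proof.
move=> i_n; rewrite /cycle_mon (has_link _ i_n).
rewrite (@has_split _ _ _ i) ?mem_iota; last lia.
rewrite {1}/star_part leqnn.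
rewrite /off_star /star_init_mon /link_part /=.
by do ![case: has] => /=; lia.
Qed.

Lemma cycle_mon_up : up_closed (cycle_mon n).
Proof.
move=> m u; rewrite !(@cycle_mon_star_init n) ?n_gt0 ?leqnn //.
exact/star_init_mon_up/off_star_up.
Qed.

(** The variables of f_{n+1}, with x_{3n+1} as c_0. *)
Definition last_vars : seq 'I_(3 * n).+2 := B n.+1 :: [seq C j | j <- iota 0 n.+1].

Lemma last_vars_uniq : uniq last_vars.
Proof.
rewrite /last_vars cons_uniq map_inj_in_uniq ?iota_uniq ?andbT.
  apply/mapP=> -[j]; rewrite mem_iota => j_n /eqP.
  by rewrite left_right //; lia.
move=> i j; rewrite !mem_iota => i_n j_n /eqP; rewrite right_eq; [|lia|lia].
by move/eqP.
Qed.

(** If no c_j divides m then b_{n+1} is free, its only generators being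
    c_n b_{n+1} and b_{n+1} c_0. Otherwise the first c_j dividing m is free:
    all generators are squarefree in c_j except c_j^2 c_{j-1}. *)
Lemma last_regular (k : fieldType) :
  regular_mod (k := k) (mon_ideal (cycle_mon n)) (\sum_(x <- last_vars) 'X_x).
Proof.
apply: regular_mod_sum_vars; [exact: cycle_mon_up | exact: last_vars_uniq |].
move=> m Mm.
have [noC | /allPn[j0 j0n mj0]] := boolP (all (fun j => m (C j) == 0%N) (iota 0 n.+1)).
  have C0 j : (j <= n)%N -> m (C j) = 0%N.
    by move=> j_n; apply/eqP/(allP noC); rewrite mem_iota; lia.
  exists (B n.+1) => [|t]; first by rewrite inE eqxx.
  set m' := (_ + _)%MM.
  have m'E x : x != B n.+1 -> m' x = m x.
    by move=> xB; rewrite /m' mnmDE mulmnE mnm1E eq_sym (negbTE xB) addn0.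
  have C'0 j : (j <= n)%N -> m' (C j) = 0%N.
    by move=> j_n; rewrite m'E ?C0 // eq_sym left_right ?andbT //; lia.
  apply: contra Mm => /or3P[/hasP[i]|/hasP[i]|]; last by rewrite !C'0 ?andbF.
    rewrite mem_iota => i_n Mi; apply/or3P/Or31/hasP; exists i; rewrite ?mem_iota //.
    move: Mi; rewrite /star_part !C'0 ?andbF; [|lia|lia].
    rewrite !m'E ?left_eq ?center_left //; try lia.
    by case: ifP; lia.
  by rewrite mem_iota /link_part => i_n; rewrite C'0 ?andbF //; lia.
have exC : exists j, (j <= n)%N && (0 < m (C j))%N.
  by exists j0; move: j0n mj0; rewrite mem_iota; lia.
case: (ex_minnP exC) => j /andP[j_n mj] j_min.
exists (C j) => [|t]; first by rewrite inE map_f ?orbT // mem_iota; lia.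
set m' := (_ + _)%MM.
have m'E x : x != C j -> m' x = m x.
  by move=> xC; rewrite /m' mnmDE mulmnE mnm1E eq_sym (negbTE xC) addn0.
have m'_gt0 x : (0 < m' x)%N = (0 < m x)%N.
  by rewrite /m' mnmDE mulmnE mnm1E; case: eqVneq => [<-|_]; lia.
apply: contra Mm => /or3P[/hasP[i i_n Mi]|/hasP[i i_n Mi]|]; last first.
- by rewrite !m'_gt0 => Mn; apply/or3P/Or33.
- by apply/or3P/Or32/hasP; exists i => //; move: Mi; rewrite /link_part !m'_gt0.
apply/or3P/Or31/hasP; exists i => //; move: i_n Mi; rewrite mem_iota /star_part => i_n.
rewrite !m'_gt0 m'E ?left_right; try lia.
have [ij | ij] := eqVneq i j; last first.
  by rewrite m'E // right_eq //; lia.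
have -> : (0 < m (C i.-1))%N = false.
  by apply/negP=> mi; have := j_min i.-1; rewrite mi; lia.
by rewrite !andbF.
Qed.

Lemma cycle_graph_irr : irreflexive (@cycle_graph (3 * n).+2).
Proof.
move=> i; rewrite /cycle_graph orbb -val_eqE /=; have := ltn_ord i.
have [lt_i | ge_i] := ltnP i.+1 (3 * n).+2; first by rewrite modn_small //; lia.
by move=> lt_i; rewrite (_ : i.+1 = (3 * n).+2) ?modnn; lia.
Qed.

Lemma cycle_graph_succ (x y : 'I_(3 * n).+2) :
  (y = x.+1 :> nat) \/ (x = 3 * n + 1 :> nat /\ y = 0 :> nat)%N ->
  cycle_graph x y.
Proof.
move=> xy; apply/orP; left; rewrite -val_eqE /=; case: xy => [yx | [-> ->]].
  by rewrite yx modn_small // -yx.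
by rewrite addn1 modnn.
Qed.

(** Going round the cycle from a_1 at position 0, the residue modulo 3 tells
    whether an edge is a_i c_i, a link c_i b_{i+1}, or b_{i+1} a_{i+1}; the edges
    at positions 3n-1, 3n and 3n+1 (b_{n+1} c_0, c_0 b_1 and b_1 a_1) are the
    exceptions. *)
Lemma edge_mon_cycle m : edge_mon (@cycle_graph (3 * n).+2) m = cycle_mon 0 m.
Proof.
have edgeI (x y : 'I_(3 * n).+2) :
    (y = x.+1 :> nat) \/ (x = 3 * n + 1 :> nat /\ y = 0 :> nat)%N ->
    (0 < m x)%N -> (0 < m y)%N -> edge_mon (@cycle_graph (3 * n).+2) m.
  move=> /cycle_graph_succ xy mx my.
  by apply/existsP; exists x; apply/existsP; exists y; rewrite xy mx my.
apply/idP/idP=> [|/or3P[/hasP[i]|/hasP[i]|/andP[mx my]]]; last 1 first.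
- by apply: (edgeI (B n.+1) (C 0)); rewrite // val_left ?val_right //=; case: eqP; lia.
- suff edge_case (x y : 'I_(3 * n).+2) :
      y = ordS x -> (0 < m x)%N -> (0 < m y)%N -> cycle_mon 0 m.
    case/existsP=> x /existsP[y /and3P[/orP[] /eqP xy mx my]].
      exact: edge_case xy mx my.
    exact: edge_case xy my mx.
  move/(congr1 val) => /= yx; have := ltn_ord x; have := ltn_ord y => y_n x_n.
  have {}yx : if x == (3 * n + 1)%N :> nat then y = 0%N :> nat else y = x.+1 :> nat.
    rewrite yx; case: eqP => [-> | xn]; first by rewrite addn1 modnn.
    by rewrite modn_small //; lia.
  have xE := divn_eq x 3; have := ltn_pmod x (isT : 0 < 3)%N.
  set q := (x %/ 3)%N in xE *; set r := (x %% 3)%N in xE *.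
  move: yx; case: eqP => [xl yx _ | xl yx r3] mx my.
    apply/or3P/Or31/hasP; exists 1%N; first by rewrite mem_iota; lia.
    rewrite /star_part /link_part /=.
    have <- : y = A 1 by apply: val_inj; rewrite /= val_center; lia.
    have <- : x = B 1 by apply: val_inj; rewrite /= val_left //=; lia.
    by rewrite my mx.
  have [r0 | [r1 | r2]] : r = 0%N \/ r = 1%N \/ r = 2%N by lia.
  - have [qn | qn] := ltnP q n.
      apply/or3P/Or31/hasP; exists q.+1; first by rewrite mem_iota; lia.
      rewrite /star_part /link_part /=.
      have <- : x = A q.+1 by apply: val_inj; rewrite /= val_center; lia.
      have <- : y = C q.+1 by apply: val_inj; rewrite /= val_right /=; lia.
      by rewrite mx my orbT.
    apply/or3P/Or32/hasP; exists 1%N; first by rewrite mem_iota; lia.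
    rewrite /star_part /link_part /=.
    have <- : x = C 0 by apply: val_inj; rewrite /= val_right //=; lia.
    have <- : y = B 1 by apply: val_inj; rewrite /= val_left //=; lia.
    by rewrite mx my.
  - apply/or3P/Or32/hasP; exists q.+2; first by rewrite mem_iota; lia.
    rewrite /star_part /link_part /=.
    have <- : x = C q.+1 by apply: val_inj; rewrite /= val_right /=; lia.
    have <- : y = B q.+2 by apply: val_inj; rewrite /= val_left /=; lia.
    by rewrite mx my.
  - have [qn | qn] := ltnP q.+1 n.
      apply/or3P/Or31/hasP; exists q.+2; first by rewrite mem_iota; lia.
      rewrite /star_part /=.
      have <- : y = A q.+2 by apply: val_inj; rewrite /= val_center; lia.
      have <- : x = B q.+2 by apply: val_inj; rewrite /= val_left /=; lia.
      by rewrite my mx.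
    apply/or3P/Or33.
    have <- : x = B n.+1.
      by apply: val_inj; rewrite /= val_left /=; [case: eqP|]; lia.
    have <- : y = C 0 by apply: val_inj; rewrite /= val_right //=; lia.
    by rewrite mx my.
- rewrite mem_iota /star_part => i_n; have -> : (i <= 0)%N = false by lia.
  case/andP=> mA /orP[mB | mC].
    have [i1 | i1] := eqVneq i 1%N.
      by apply: (edgeI (B i) (A i)) => //; rewrite val_center ?val_left ?i1 //=; lia.
    apply: (edgeI (B i) (A i)) => //; rewrite val_center ?val_left; try lia.
    by rewrite (negbTE i1); lia.
  by apply: (edgeI (A i) (C i)); rewrite // val_center ?val_right //; try lia; case: (i =P _); lia.
- rewrite mem_iota /link_part => i_n /andP[mB mC].
  apply: (edgeI (C i.-1) (B i)); rewrite // val_left ?val_right; try lia.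
  by case: (i =P _); case: (i.-1 =P _); lia.
Qed.

(** * The chain of initial ideals *)

Variables (k : fieldType) (le : rel 'X_{1..(3 * n).+2}).
Hypothesis le_to : term_order le.
Hypothesis gt_star : forall i, (0 < i <= n)%N ->
  mon_gt le U_(center i)%MM U_(left_leaf i)%MM /\
  mon_gt le U_(left_leaf i)%MM U_(right_leaf i)%MM.

Lemma cycle_seq_star i : (0 < i <= n)%N ->
  cycle_seq k n i = 'X_(center i) + 'X_(left_leaf i) + 'X_(right_leaf i).
Proof.
move=> i_n; have /andP[i0 le_in] := i_n; rewrite /cycle_seq /xvar /xmon.
rewrite /center /left_leaf /right_leaf.
have [-> | i1] := eqVneq i 1%N.
  by rewrite addn2 addn1.
by rewrite le_in; congr ('X_(inord _) + 'X_(inord _) + 'X_(inord _));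
  rewrite ?(gtn_eqF i0); lia.
Qed.

Lemma cycle_seq_last : cycle_seq k n n.+1 = \sum_(x <- last_vars) 'X_x.
Proof.
rewrite /cycle_seq ltnn eqSS (gtn_eqF n_gt0) /last_vars big_cons big_map.
rewrite -addrA; congr (_ + _).
  rewrite /xvar /xmon /left_leaf eqSS (gtn_eqF n_gt0).
  by congr 'X_(inord _); lia.
rewrite -[iota 0 n.+1]/(0%N :: iota 1 n) big_cons; congr (_ + _).
  by rewrite /xvar /xmon /right_leaf /= addn1.
rewrite /index_iota subn1 /=; apply: eq_big_seq => j; rewrite mem_iota => j_n.
rewrite /xvar /xmon /right_leaf; congr 'X_(inord _).
by case: (j =P 0%N); lia.
Qed.

Lemma star_uniq i : (0 < i <= n)%N ->
  uniq [:: center i; left_leaf i; right_leaf i].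
Proof.
by move=> i_n; rewrite /= !inE center_left ?center_right ?left_right //; lia.
Qed.

Lemma prev_leaf_out i : (0 < i <= n)%N ->
  right_leaf i.-1 \notin [:: center i; left_leaf i; right_leaf i].
Proof.
move=> i_n; rewrite !inE ![right_leaf i.-1 == _]eq_sym.
by rewrite center_right ?left_right ?right_eq //; lia.
Qed.

Lemma next_leaf_out i : (0 < i <= n)%N ->
  left_leaf i.+1 \notin [:: center i; left_leaf i; right_leaf i].
Proof.
move=> i_n; rewrite !inE [_ == center i]eq_sym.
by rewrite center_left ?left_right ?left_eq //; lia.
Qed.

Let f := [seq cycle_seq k n i | i <- iota 1 n.+1].

Lemma nth_cycle_seq i : (i <= n)%N -> f`_i = cycle_seq k n i.+1.
Proof. by move=> i_n; rewrite (nth_map 0%N) ?size_iota // nth_iota. Qed.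

(** After i steps the first i stars are in their final form and the others are
    untouched. *)
Lemma init_chain_cycle i : (i <= n)%N ->
  forall p, init_chain le (edge_ideal (@cycle_graph (3 * n).+2)) f i p
            <-> mon_ideal (cycle_mon i) p.
Proof.
elim: i => [_ p | i IH i_n p] /=.
  rewrite /mon_ideal -(eq_all (edge_mon_cycle)).
  exact/init_edge_ideal/le_to/cycle_graph_irr.
have i1_n : (0 < i.+1 <= n)%N by [].
rewrite nth_cycle_seq 1?ltnW // cycle_seq_star //.
rewrite /mon_ideal (eq_all (fun m => cycle_mon_star_init m i1_n)).
have [gt_ab gt_bc] := gt_star i1_n.
apply: init_star => //; rewrite ?star_uniq ?prev_leaf_out ?next_leaf_out //.
- exact: off_star_up.
- by move=> m m'; apply: off_star_out.
- move=> q; rewrite IH 1?ltnW // /mon_ideal.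
  by rewrite (eq_all (fun m => cycle_mon_star m i1_n)).
Qed.

Lemma cycle_seq_initially_regular :
  initially_regular le (edge_ideal (@cycle_graph (3 * n).+2)) f.
Proof.
move=> i; rewrite size_map size_iota ltnS => i_n; rewrite nth_cycle_seq //.
have reg g := @regular_mod_iff k _ _ _ g (init_chain_cycle i_n).
have [lt_in | ge_in] := ltnP i n; last first.
  have Ei : i = n by apply/eqP; rewrite eqn_leq i_n.
  rewrite {1}Ei cycle_seq_last; split.
    by apply: nonconstant_sum_vars; first exact: last_vars_uniq.
  by apply: reg; rewrite Ei cycle_seq_last; apply: last_regular.
have i1_n : (0 < i.+1 <= n)%N by [].
rewrite cycle_seq_star //; split.
  have -> : 'X_(center i.+1) + 'X_(left_leaf i.+1) + 'X_(right_leaf i.+1)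
      = \sum_(x <- [:: center i.+1; left_leaf i.+1; right_leaf i.+1]) 'X_x
      :> {mpoly k[_]}.
    by rewrite !big_cons big_nil addr0 addrA.
  by apply: nonconstant_sum_vars; first exact: star_uniq.
apply: reg => g; rewrite /mon_ideal !(eq_all (fun m => cycle_mon_star m i1_n)).
apply: star_regular; rewrite ?star_uniq ?prev_leaf_out ?next_leaf_out //.
- exact: off_star_up.
- by move=> m m'; apply: off_star_out.
Qed.

End Cycle.

Theorem theorem3p3 (k : fieldType) (n : nat) (hn : (1 <= n)%N)
    (le : rel 'X_{1..(3 * n).+2}) (hle : term_order le)
    (h1 : mon_gt le (xmon (3 * n).+1 1) (xmon (3 * n).+1 (3 * n + 2)) /\
          mon_gt le (xmon (3 * n).+1 (3 * n + 2)) (xmon (3 * n).+1 2))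
    (hi : forall i : nat, (2 <= i <= n)%N ->
          mon_gt le (xmon (3 * n).+1 (3 * i - 2)) (xmon (3 * n).+1 (3 * i - 3)) /\
          mon_gt le (xmon (3 * n).+1 (3 * i - 3)) (xmon (3 * n).+1 (3 * i - 1))) :
  initially_regular le (edge_ideal (k := k) (@cycle_graph (3 * n).+2))
    [seq cycle_seq k n i | i <- iota 1 n.+1].
Proof.
apply: cycle_seq_initially_regular => // i i_n.
have [-> | i1] := eqVneq i 1%N.
  by move: h1; rewrite /xmon /center /left_leaf /right_leaf addn2 addn1.
have /hi : (2 <= i <= n)%N by lia.
rewrite /xmon /center /left_leaf /right_leaf (negbTE i1).
have -> : (i == 0)%N = false by lia.
have -> : (3 * i - 2).-1 = (3 * i - 3)%N by lia.
have -> : (3 * i - 3).-1 = (3 * i - 4)%N by lia.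
by have -> : (3 * i - 1).-1 = (3 * i - 2)%N by lia.
Qed.
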